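(* Let $p$ be a prime and let $F$ be a finite field of characteristic $p$. Then the order of the $*$-unitary subgroup of $FG$ determines the order of the finite $p$-group $G$; that is, if $G_1$ and $G_2$ are finite $p$-groups with $|V_*(FG_1)|=|V_*(FG_2)|$, then $|G_1|=|G_2|$.
   Context: For a finite group $G$ and a field $F$, $FG$ is the group algebra, and $\chi\left(\sum_{g\in G}\alpha_g g\right)=\sum_{g\in G}\alpha_g$ is the augmentation map. For $G$ a finite $p$-group and $F$ of characteristic $p$, $V(FG)=\{x\in FG \mid \chi(x)=1\}$ is the group of normalized units of $FG$. The canonical involution $*$ of $FG$ is the $F$-linear extension of $g\mapsto g^{-1}$, i.e. $\left(\sum_{g\in G}\alpha_g g\right)^*=\sum_{g\in G}\alpha_g g^{-1}$. The $*$-unitary subgroup is $V_*(FG)=\{u\in V(FG)\mid u^*=u^{-1}\}$. *)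

(* Defs.v *)
From HB Require Import structures.
From mathcomp Require Import all_boot all_algebra all_fingroup all_solvable.

Set Implicit Arguments.
Unset Strict Implicit.
Unset Printing Implicit Defensive.

Import GRing.Theory.
Local Open Scope ring_scope.

(* A group algebra element is its coefficient function.  The alias hides the
   pointwise product of {ffun _ -> _}; F^o makes F act by scaling. *)
Definition group_algebra (F : fieldType) (gT : finGroupType) : Type :=
  {ffun gT -> F^o}.

Section GroupAlgebra.

Variables (F : fieldType) (gT : finGroupType).
Local Notation FG := (group_algebra F gT).
Implicit Types (x y z : FG) (g h : gT).

HB.instance Definition _ := GRing.Lmodule.on FG.

Definition ga_coef x g : F := (x : {ffun gT -> F^o}) g.

Definition ga_elt g : FG := [ffun h => (h == g)%:R].

(* The coefficient of g in x * y collects all factorizations g = h (h^-1 g). *)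
Definition ga_mul x y : FG :=
  [ffun g => \sum_h ga_coef x h * ga_coef y (h^-1 * g)%g].

Lemma ga_coefP x y : ga_coef x =1 ga_coef y -> x = y.
Proof. by move=> exy; apply/ffunP. Qed.

Lemma ga_coefD x y g : ga_coef (x + y) g = ga_coef x g + ga_coef y g.
Proof. exact: ffunE. Qed.

Lemma ga_coefZ a x g : ga_coef (a *: x) g = a * ga_coef x g.
Proof. exact: ffunE. Qed.

Lemma ga_coef_sum (I : finType) (f : I -> FG) g :
  ga_coef (\sum_i f i) g = \sum_i ga_coef (f i) g.
Proof. exact: sum_ffunE. Qed.

Lemma ga_coef_elt g h : ga_coef (ga_elt g) h = (h == g)%:R.
Proof. exact: ffunE. Qed.

Lemma ga_coef_mul x y g :
  ga_coef (ga_mul x y) g = \sum_h ga_coef x h * ga_coef y (h^-1 * g)%g.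
Proof. exact: ffunE. Qed.

Fact ga_mulA : associative ga_mul.
Proof.
move=> x y z; apply: ga_coefP => g; rewrite !ga_coef_mul.
under [RHS]eq_bigr => k _ do rewrite ga_coef_mul mulr_suml.
rewrite exchange_big /=; apply: eq_bigr => h _.
rewrite ga_coef_mul mulr_sumr (reindex_inj (mulgI h^-1%g)) /=.
by apply: eq_bigr => k _; rewrite mulrA invMg invgK mulgA mulgK.
Qed.

Fact ga_mul1 : left_id (ga_elt 1) ga_mul.
Proof.
move=> x; apply: ga_coefP => g; rewrite ga_coef_mul (bigD1 1%g) //= big1.
  by rewrite ga_coef_elt eqxx mul1r invg1 mul1g addr0.
by move=> h /negPf h1; rewrite ga_coef_elt h1 mul0r.
Qed.

Fact ga_mulr1 : right_id (ga_elt 1) ga_mul.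
Proof.
move=> x; apply: ga_coefP => g; rewrite ga_coef_mul (bigD1 g) //= big1.
  by rewrite ga_coef_elt mulVg eqxx mulr1 addr0.
by move=> h /negPf hg; rewrite ga_coef_elt -eq_mulVg1 hg mulr0.
Qed.

Fact ga_mulDl : left_distributive ga_mul +%R.
Proof.
move=> x y z; apply: ga_coefP => g; rewrite ga_coefD !ga_coef_mul -big_split.
by apply: eq_bigr => h _; rewrite ga_coefD mulrDl.
Qed.

Fact ga_mulDr : right_distributive ga_mul +%R.
Proof.
move=> x y z; apply: ga_coefP => g; rewrite ga_coefD !ga_coef_mul -big_split.
by apply: eq_bigr => h _; rewrite ga_coefD mulrDr.
Qed.

Fact ga_one_neq0 : ga_elt 1 != 0.
Proof.
apply/eqP=> /(congr1 (ga_coef^~ 1%g)) /eqP.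
by rewrite ga_coef_elt eqxx [ga_coef 0 _]ffunE oner_eq0.
Qed.

HB.instance Definition _ := GRing.Zmodule_isNzRing.Build FG
  ga_mulA ga_mul1 ga_mulr1 ga_mulDl ga_mulDr ga_one_neq0.

Fact ga_scalerAl (a : F) x y : a *: (x * y) = (a *: x) * y.
Proof.
apply: ga_coefP => g; rewrite ga_coefZ !ga_coef_mul mulr_sumr.
by apply: eq_bigr => h _; rewrite ga_coefZ mulrA.
Qed.

HB.instance Definition _ := GRing.Lmodule_isLalgebra.Build F FG ga_scalerAl.

Fact ga_scalerAr (a : F) x y : a *: (x * y) = x * (a *: y).
Proof.
apply: ga_coefP => g; rewrite ga_coefZ !ga_coef_mul mulr_sumr.
by apply: eq_bigr => h _; rewrite ga_coefZ mulrCA.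
Qed.

HB.instance Definition _ := GRing.Lalgebra_isAlgebra.Build F FG ga_scalerAr.

Lemma ga_sumE x : x = \sum_g ga_coef x g *: ga_elt g.
Proof.
apply: ga_coefP => h; rewrite ga_coef_sum (bigD1 h) //= big1.
  by rewrite ga_coefZ ga_coef_elt eqxx mulr1 addr0.
by move=> g; rewrite eq_sym => /negPf gh; rewrite ga_coefZ ga_coef_elt gh mulr0.
Qed.

Lemma ga_elt1 : ga_elt 1 = 1.
Proof. by []. Qed.

Lemma ga_eltM g h : ga_elt (g * h) = ga_elt g * ga_elt h.
Proof.
apply: ga_coefP => k; rewrite ga_coef_mul (bigD1 g) //= big1.
  by rewrite !ga_coef_elt eqxx mul1r addr0 -(inj_eq (mulgI g^-1%g)) mulKg.
by move=> l /negPf lg; rewrite ga_coef_elt lg mul0r.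
Qed.

Definition augmentation x : F := \sum_g ga_coef x g.

Definition ga_star x : FG := \sum_g ga_coef x g *: ga_elt g^-1.

End GroupAlgebra.

(* Over a finite field the group algebra is a finite ring, so inverses are
   decidable and the unit ring structure is available. *)
Section Finite.

Variables (F : finFieldType) (gT : finGroupType).
Local Notation FG := (group_algebra F gT).

HB.instance Definition _ := Finite.copy FG {ffun gT -> F}.
HB.instance Definition _ := FinRing.isNzRing.Build FG.

(* When gT is a p-group and F has characteristic p, every element of
   augmentation 1 is a unit. *)
Definition normalized_units : {set FG} := [set x | augmentation x == 1].

(* u^-1 is the two-sided inverse of a unit u; its conventional value at
   non-units plays no role in the setting of the previous comment. *)
Definition star_unitary : {set FG} :=
  [set u in normalized_units | ga_star u == u^-1].

End Finite.

Arguments normalized_units F gT : clear implicits.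
Arguments star_unitary F gT : clear implicits.

(* Main.v *)
(* Write n = |G| and q = |F|.  For u and v in V(FG), u u^* = v v^* exactly when
   v^-1 u is unitary, so |V(FG)| = q^(n-1) is |V_*(FG)| times the number of
   values of u u^*.  Such a value is symmetric, has augmentation 1 and vanishes
   at every involution of G (in characteristic 2 the terms of the coefficient
   cancel in pairs), hence it is determined by its coefficients at one element
   of each pair {g, g^-1} with g <> g^-1.  So there are at most
   q^floor((n-1)/2) values, and q^floor(n/2) <= |V_*(FG)| <= q^(n-1).  Orders
   of p-groups that differ do so by a factor of at least 2, which makes these
   ranges disjoint for different orders. *)
Require Import Defs.
From mathcomp Require Import all_boot all_algebra all_fingroup all_solvable.
From mathcomp Require Import zify.

Set Implicit Arguments.
Unset Strict Implicit.
Unset Printing Implicit Defensive.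

Import GRing.Theory.
Local Open Scope ring_scope.

(** * Coefficients, involution and augmentation in a group algebra *)

Section GroupAlgebraTheory.

Variables (F : fieldType) (gT : finGroupType).
Local Notation FG := (group_algebra F gT).
Implicit Types (x y z : FG) (g h : gT).

Lemma ga_coef0 g : ga_coef (0 : FG) g = 0.
Proof. exact: ffunE. Qed.

Lemma ga_coef1 g : ga_coef (1 : FG) g = (g == 1%g)%:R.
Proof. exact: ga_coef_elt. Qed.

Lemma ga_coefM x y g :
  ga_coef (x * y) g = \sum_h ga_coef x h * ga_coef y (h^-1 * g)%g.
Proof. exact: ga_coef_mul. Qed.

Lemma ga_coef_mul_elt x g h :
  ga_coef (x * ga_elt F g) h = ga_coef x (h * g^-1)%g.
Proof.
rewrite ga_coefM (bigD1 (h * g^-1)%g) //= big1 => [|k kP].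
  by rewrite ga_coef_elt invMg invgK mulgKV eqxx mulr1 addr0.
rewrite ga_coef_elt; case: eqP => [E|_]; last by rewrite mulr0.
by case/eqP: kP; rewrite -E invMg invgK mulKVg.
Qed.

Lemma ga_coef_star x g : ga_coef (ga_star x) g = ga_coef x g^-1%g.
Proof.
rewrite ga_coef_sum (bigD1 g^-1%g) //= big1 => [|k kP].
  by rewrite ga_coefZ ga_coef_elt invgK eqxx mulr1 addr0.
rewrite ga_coefZ ga_coef_elt; case: eqP => [E|_]; last by rewrite mulr0.
by case/eqP: kP; rewrite E invgK.
Qed.

Lemma ga_starK : involutive (@ga_star F gT).
Proof. by move=> x; apply: ga_coefP => g; rewrite !ga_coef_star invgK. Qed.

Lemma ga_star1 : ga_star (1 : FG) = 1.
Proof.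
by apply: ga_coefP => g; rewrite ga_coef_star !ga_coef1 eq_invg1.
Qed.

Lemma ga_starM x y : ga_star (x * y) = ga_star y * ga_star x.
Proof.
apply: ga_coefP => g; rewrite ga_coef_star !ga_coefM.
rewrite (reindex_inj (mulgI g^-1%g)) /=; apply: eq_bigr => h _.
by rewrite !ga_coef_star !invMg !invgK mulgK mulrC.
Qed.

Lemma augmentationD x y :
  augmentation (x + y) = augmentation x + augmentation y.
Proof. by rewrite -big_split; apply: eq_bigr => g _; rewrite ga_coefD. Qed.

Lemma augmentationZ a x : augmentation (a *: x) = a * augmentation x.
Proof. by rewrite mulr_sumr; apply: eq_bigr => g _; rewrite ga_coefZ. Qed.

Lemma augmentation1 : augmentation (1 : FG) = 1.
Proof.
rewrite /augmentation (bigD1 1%g) //= big1 => [|g /negPf g1].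
  by rewrite ga_coef1 eqxx addr0.
by rewrite ga_coef1 g1.
Qed.

Lemma augmentationM x y :
  augmentation (x * y) = augmentation x * augmentation y.
Proof.
rewrite /augmentation mulr_suml.
under eq_bigr do rewrite ga_coefM.
rewrite exchange_big; apply: eq_bigr => h _.
by rewrite (reindex_inj (mulgI h)) mulr_sumr; under eq_bigr do rewrite mulKg.
Qed.

Lemma augmentation_star x : augmentation (ga_star x) = augmentation x.
Proof.
rewrite /augmentation (reindex_inj invg_inj).
by apply: eq_bigr => g _; rewrite ga_coef_star invgK.
Qed.

(** Such a [y] is a multiple of the sum of all group elements, on which [x] acts through its
    augmentation. *)
Lemma ga_mul_const x y c :
  (forall g, ga_coef y g = c) ->
  forall g, ga_coef (x * y) g = augmentation x * c.
Proof.
move=> yc g; rewrite ga_coefM mulr_suml.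
by apply: eq_bigr => h _; rewrite yc.
Qed.

(** * Symmetric elements and the products x x^* *)

Lemma star_mul_star x : ga_star (x * ga_star x) = x * ga_star x.
Proof. by rewrite ga_starM ga_starK. Qed.

(** Left translation by the involution [g] has no fixed point and preserves the term [f h], so equal
    terms pair off. *)
Lemma coef_mul_star_involution x g :
  2%N \in [pchar F] -> g != 1%g -> g^-1%g = g ->
  ga_coef (x * ga_star x) g = 0.
Proof.
move=> F2 g1 gV; pose f h := ga_coef x h * ga_coef x (g * h)%g.
have ->: ga_coef (x * ga_star x) g = \sum_h f h.
  rewrite ga_coefM; apply: eq_bigr => h _.
  by rewrite ga_coef_star invMg invgK gV.
have gg h : (g * (g * h) = h)%g by rewrite -{1}gV mulKg.
(* Comparing ranks selects one element of each pair {h, g h}. *)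
pose r (h : gT) := nat_of_ord (enum_rank h).
rewrite (bigID (fun h => r h < r (g * h)%g)%N) /=.
rewrite [X in _ + X](reindex_inj (mulgI g)) /=.
rewrite [X in _ + X](_ : _ = \sum_(h | (r h < r (g * h)%g)%N) f h).
  by rewrite (addrr_pchar2 F2).
apply: eq_big => [h|h _]; last by rewrite /f gg mulrC.
rewrite gg -leqNgt leq_eqVlt orbC; case: ltnP => //= _.
apply/eqP => /val_inj /enum_rank_inj /esym /eqP.
by rewrite -{2}[h]mul1g (inj_eq (mulIg h)) (negPf g1).
Qed.

(* One representative of each pair {g, g^-1} with g <> g^-1. *)
Definition half_group : {set gT} :=
  [set g | (enum_rank g < enum_rank g^-1%g)%N].

(** [half_group] and its set of inverses are disjoint, of equal size, and both miss 1. *)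
Lemma card_half_group : (#|half_group| <= (#|gT|.-1)./2)%N.
Proof.
have dis : [disjoint half_group & (half_group^-1)%g].
  rewrite -setI_eq0; apply/eqP/setP => g; rewrite !inE invgK.
  by case: ltngtP.
have H1 : (1%g : gT) \notin half_group :|: (half_group^-1)%g.
  by rewrite !inE !invg1 ltnn.
have := max_card [in (1%g : gT) |: (half_group :|: (half_group^-1)%g)].
rewrite cardsU1 H1 cardsU (disjoint_setI0 dis) cards0 subn0 card_invg.
have half_pred m n : (true + (m + m) <= n -> m <= n.-1./2)%N by lia.
exact: half_pred.
Qed.

(** Symmetry carries agreement on [half_group] over to the inverses; once all other coefficients
    agree, the augmentation fixes the one at 1. *)
Lemma ga_symmetric_ext x y :
    ga_star x = x -> ga_star y = y -> augmentation x = augmentation y ->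
    (forall g, g != 1%g -> g^-1%g = g -> ga_coef x g = ga_coef y g) ->
    {in half_group, ga_coef x =1 ga_coef y} ->
  x = y.
Proof.
move=> sx sy axy inv_xy half_xy.
have neq1 g : g != 1%g -> ga_coef x g = ga_coef y g.
  move=> g1; case: (ltngtP (enum_rank g) (enum_rank g^-1%g)) => [lt|gt|].
  - by apply: half_xy; rewrite inE.
  - rewrite -sx -sy !ga_coef_star; apply: half_xy.
    by rewrite inE invgK.
  - by move=> /val_inj /enum_rank_inj /esym; apply: inv_xy.
apply: ga_coefP => g; have [->|] := eqVneq g 1%g; last exact: neq1.
move: axy; rewrite /augmentation (bigD1 1%g) //= [RHS](bigD1 1%g) //=.
by rewrite (eq_bigr _ neq1) => /addIr.
Qed.

End GroupAlgebraTheory.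

Arguments half_group gT : clear implicits.

(** * Counting over a finite field *)

Section Finite.

Variables (F : finFieldType) (gT : finGroupType).
Local Notation FG := (group_algebra F gT).
Local Notation V := (normalized_units F gT).
Implicit Types (x y z : FG) (g h : gT).

Lemma card_group_algebra : #|{: FG}| = (#|F| ^ #|gT|)%N.
Proof. exact: card_ffun. Qed.

(** Translations by multiples of [u] preserve [A] and shift [phi], so all fibres of [phi] on [A]
    have the same size. *)
Lemma card_fiber (A : {set FG}) (phi : FG -> F) u b :
    (forall a x, x \in A -> x + a *: u \in A) ->
    (forall a x, phi (x + a *: u) = phi x + a) ->
  #|A| = (#|F| * #|[set x in A | phi x == b]|)%N.
Proof.
move=> Au phiu; have Aeq a x : (x + a *: u \in A) = (x \in A).
  apply/idP/idP; last exact: Au.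
  by move/(Au (- a)); rewrite scaleNr addrK.
rewrite -[LHS]sum1_card (partition_big phi predT) //= -sum_nat_const.
apply: eq_bigr => a _; rewrite -sum1_card.
(* This translation carries the fibre over [b] onto the fibre over [a]. *)
rewrite (reindex_inj (addIr ((a - b) *: u))) /=.
apply: eq_bigl => x; rewrite inE Aeq phiu; congr (_ && _).
by rewrite -[RHS](inj_eq (addIr (a - b))) subrKC.
Qed.

Lemma card_normalized_units : #|V| = (#|F| ^ #|gT|.-1)%N.
Proof.
have F_gt0 : (0 < #|F|)%N by apply/card_gt0P; exists 0.
have G_gt0 : (0 < #|gT|)%N by apply/card_gt0P; exists 1%g.
apply/eqP; rewrite -(eqn_pmul2l F_gt0) -expnS prednK //.
rewrite -card_group_algebra -(cardsT FG).
rewrite (@card_fiber setT (@augmentation F gT) 1 1) => [||a x].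
- by apply/eqP; congr (_ * _)%N; apply: eq_card => x; rewrite !inE.
- by move=> a x; rewrite !inE.
- by rewrite augmentationD augmentationZ augmentation1 mulr1.
Qed.

Lemma card_star_unitary_le : (#|star_unitary F gT| <= #|F| ^ #|gT|.-1)%N.
Proof.
by rewrite -card_normalized_units; apply/subset_leq_card/subsetP => x /setIdP[].
Qed.

(** * Invertibility of elements of augmentation 1 for a p-group *)

Section PGroup.

Variables (p : nat) (charF : p \in [pchar F]) (pG : (p.-group [set: gT])%g).

(** The unit 1 has additive order [p], so Lagrange applies to the additive group of [F]. *)
Lemma dvdn_card_field : (p %| #|F|)%N.
Proof.
have <- : #[(1%R : F)]%g = p.
  apply: nt_prime_order; rewrite ?(pcharf_prime charF) //.
    by rewrite FinRing.zmodXgE pcharf0.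
  exact: oner_neq0.
by rewrite -cardsT; exact/order_dvdG/in_setT.
Qed.

Fact ga_elt_act_is_action : is_action setT (fun x g => x * ga_elt F g).
Proof.
apply: is_total_action => [x|x g h]; first by rewrite ga_elt1 mulr1.
by rewrite ga_eltM mulrA.
Qed.

Definition ga_elt_act := Action ga_elt_act_is_action.

(* The right annihilator of x is acted upon by the p-group G, so if it were not
   0 it would contain a nonzero multiple of the sum of G. *)
Lemma normalized_unit_lreg x : augmentation x = 1 -> GRing.lreg x.
Proof.
move=> x1; pose A := [set y : FG | x * y == 0].
suff A0 y : y \in A -> y = 0.
  move=> y z /eqP; rewrite -subr_eq0 -mulrBr => xyz.
  by apply/eqP; rewrite -subr_eq0; apply/eqP/A0; rewrite inE.
move=> Ay; apply/eqP/negPn/negP => y0.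
have [g0 yg0] : exists g0, ga_coef y g0 != 0.
  apply/existsP; apply: contraR y0; rewrite negb_exists => /forallP y0.
  by apply/eqP/ga_coefP => g; rewrite ga_coef0; apply/eqP/negPn.
have pA : (p %| #|A|)%N.
  (* Scaling [y] to have coefficient 1 at [g0] makes its multiples shift that coefficient as
     required. *)
  rewrite (@card_fiber A (fun z => ga_coef z g0) ((ga_coef y g0)^-1 *: y) 0).
  - exact/dvdn_mulr/dvdn_card_field.
  - move=> a z; rewrite !inE mulrDr => /eqP->; rewrite add0r -!scalerAr.
    by move: Ay; rewrite inE => /eqP ->; rewrite !scaler0.
  - by move=> a z; rewrite ga_coefD !ga_coefZ mulVf // mulr1.
have actsA : [acts [set: gT], on A | ga_elt_act].
  apply/actsP => g _ z; rewrite !inE /= mulrA; apply/eqP/eqP => [|->].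
    move/(congr1 (fun w => w * ga_elt F g^-1)).
    by rewrite -mulrA -ga_eltM mulgV ga_elt1 mulr1 mul0r.
  exact: mul0r.
(* The number of fixed points in [A] is divisible by [p], which is impossible if 0 is the only
   one. *)
have := pgroup_fix_mod pG actsA; rewrite (eqP pA : #|A| %% p = 0)%N.
suff -> : 'Fix_(A | ga_elt_act)([set: gT])%g = [set 0].
  by rewrite cards1 modn_small // prime_gt1 // (pcharf_prime charF).
apply/setP => z; rewrite in_setI inE in_set1; apply/andP/eqP => [[/eqP xz]|->].
  move/afixP => fixz.
  (* A fixed [z] has constant coefficients, and their common value is that of [x * z = 0], as [x]
     has augmentation 1. *)
  have zc g : ga_coef z g = ga_coef z 1%g.
    have := congr1 (fun w : FG => ga_coef w g) (fixz g (in_setT _)).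
    by rewrite /= ga_coef_mul_elt mulgV.
  apply: ga_coefP => g.
  by rewrite zc -[LHS]mul1r -x1 -(ga_mul_const x zc g) xz.
split; first by rewrite mulr0.
by apply/afixP => g _; rewrite /= mul0r.
Qed.

(** Left multiplication by [x] is injective on a finite set, hence bijective; this gives a right
    inverse, and cancelling [x] makes it two-sided. *)
Lemma normalized_unit_unit x : augmentation x = 1 -> x \is a GRing.unit.
Proof.
move/normalized_unit_lreg => xI; have [f _ xf] := injF_bij xI.
apply/unitrP; exists (f 1); split; last exact: xf.
by apply: xI; rewrite mulrA xf mulr1 mul1r.
Qed.

Lemma star_unitaryE x :
  (x \in star_unitary F gT) = (augmentation x == 1) && (x * ga_star x == 1).
Proof.
rewrite !inE; case: eqP => //= /normalized_unit_unit xU.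
by rewrite -(inj_eq (mulrI xU)) divrr.
Qed.

(** * Values of the norm x x^* and the bound on the unitary subgroup *)

Let N x : FG := x * ga_star x.

(** Multiplication by [x^-1] maps the fibre of [N] through [x] injectively into the unitary
    subgroup. *)
Lemma card_normalized_units_le : (#|V| <= #|N @: V| * #|star_unitary F gT|)%N.
Proof.
rewrite -[#|V|]sum1_card (partition_big_imset N) /= -sum_nat_const.
apply: leq_sum => _ /imsetP[x xV ->].
have x1 : augmentation x = 1 by apply/eqP; move: xV; rewrite inE.
have xU := normalized_unit_unit x1.
have x'1 : augmentation x^-1 = 1.
  by rewrite -[LHS]mul1r -x1 -augmentationM divrr ?augmentation1.
have x'U : x^-1 \is a GRing.unit by rewrite unitrV.
rewrite sum1_card -(card_imset _ (mulrI x'U)).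
apply/subset_leq_card/subsetP => _ /imsetP[y yP ->].
move: yP; rewrite inE => /andP[yV /eqP Nyx].
have y1 : augmentation y = 1 by apply/eqP; move: yV; rewrite inE.
suff: x^-1 * y \in star_unitary F gT by rewrite inE.
rewrite star_unitaryE augmentationM x'1 y1 mulr1 eqxx /=; apply/eqP.
have -> : x^-1 * y * ga_star (x^-1 * y) = x^-1 * N y * ga_star x^-1.
  by rewrite /N ga_starM !mulrA.
by rewrite Nyx /N mulrA mulVr // mul1r -ga_starM mulVr // ga_star1.
Qed.

(** An involution in a p-group forces p = 2, where the cancellation in characteristic 2 applies. *)
Lemma coef_norm_involution x g :
  g != 1%g -> g^-1%g = g -> ga_coef (N x) g = 0.
Proof.
move=> g1 gV; have g2 : (g ^+ 2 = 1)%g by rewrite expgS expg1 -{1}gV mulVg.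
have og : #[g]%g = 2%N by apply: nt_prime_order.
have p2 : p = 2%N.
  have := order_dvdG (in_setT g); rewrite og => g_dvd.
  by have := pgroupP pG 2 isT g_dvd; rewrite inE => /eqP.
by apply: coef_mul_star_involution; rewrite // -p2.
Qed.

(** Restriction of the coefficients to [half_group] is injective on norms. *)
Lemma card_norms : (#|N @: V| <= #|F| ^ (#|gT|.-1)./2)%N.
Proof.
have F_gt0 : (0 < #|F|)%N by apply/card_gt0P; exists 0.
apply: leq_trans (leq_pexp2l F_gt0 (card_half_group gT)).
pose r (s : FG) := [ffun g : {g | g \in half_group gT} => ga_coef s (val g)].
have -> : (#|F| ^ #|half_group gT| =
           #|{ffun {g | g \in half_group gT} -> F}|)%N.
  by rewrite card_ffun card_sig.
have rI : {in N @: V &, injective r}.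
  move=> _ _ /imsetP[x + ->] /imsetP[y + ->].
  rewrite !inE => /eqP x1 /eqP y1 /ffunP rxy.
  apply: ga_symmetric_ext; rewrite ?star_mul_star //.
  - by rewrite !augmentationM !augmentation_star x1 y1.
  - by move=> g g1 gV; rewrite !coef_norm_involution.
  - by move=> g gH; have := rxy (exist _ g gH); rewrite !ffunE.
by rewrite -(card_in_imset rI) max_card.
Qed.

Lemma card_star_unitary_ge : (#|F| ^ #|gT|./2 <= #|star_unitary F gT|)%N.
Proof.
have F_gt0 : (0 < #|F|)%N by apply/card_gt0P; exists 0.
have G_gt0 : (0 < #|gT|)%N by apply/card_gt0P; exists 1%g.
have q_gt0 : (0 < #|F| ^ (#|gT|.-1)./2)%N by rewrite expn_gt0 F_gt0.
rewrite -(leq_pmul2l q_gt0) -expnD.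
(* For n > 0, floor((n-1)/2) + floor(n/2) = n-1. *)
rewrite (_ : (_ + _ = #|gT|.-1)%N); last by lia.
rewrite -card_normalized_units; apply: leq_trans card_normalized_units_le _.
by rewrite leq_mul2r card_norms orbT.
Qed.

End PGroup.

End Finite.

(** * Comparison of two p-groups of different orders *)

Lemma card_star_unitary_ltn (p : nat) (F : finFieldType)
    (gT1 gT2 : finGroupType) :
    p \in [pchar F] -> (p.-group [set: gT1])%g -> (p.-group [set: gT2])%g ->
    (#|gT1| < #|gT2|)%N ->
  (#|star_unitary F gT1| < #|star_unitary F gT2|)%N.
Proof.
move=> charF pG1 pG2 lt12; have p_pr := pcharf_prime charF.
have [[a n1] [b n2]] := (p_natP pG1, p_natP pG2).
rewrite !cardsT in n1 n2.
(* Both orders are powers of [p], so the larger is at least [p >= 2] times the smaller. *)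
have le12 : (2 * #|gT1| <= #|gT2|)%N.
  rewrite n1 n2 ltn_exp2l ?prime_gt1 // in lt12 *.
  apply: (@leq_trans (p ^ a.+1)); last by rewrite leq_exp2l ?prime_gt1.
  by rewrite expnS leq_mul2r prime_gt1 ?orbT.
apply: leq_ltn_trans (card_star_unitary_le F gT1) _.
apply: leq_trans (card_star_unitary_ge charF pG2).
have G1_gt0 : (0 < #|gT1|)%N by apply/card_gt0P; exists 1%g.
(* Since 0 < |G1| and 2|G1| <= |G2|, the exponents satisfy |G1| - 1 < floor(|G2|/2). *)
by rewrite ltn_exp2l ?card_finNzRing_gt1; lia.
Qed.

Theorem corollary1 (p : nat) (p_pr : prime p)
    (F : finFieldType) (charF : p \in [pchar F]%R)
    (gT1 gT2 : finGroupType)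
    (pG1 : (p.-group [set: gT1])%g) (pG2 : (p.-group [set: gT2])%g)
    (eqV : #|star_unitary F gT1| = #|star_unitary F gT2|) :
  #|[set: gT1]| = #|[set: gT2]|.
Proof.
rewrite !cardsT; case: (ltngtP #|gT1| #|gT2|) => //.
- by move/(card_star_unitary_ltn charF pG1 pG2); rewrite eqV ltnn.
- by move/(card_star_unitary_ltn charF pG2 pG1); rewrite eqV ltnn.
Qed.
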